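(* Let $k$, $m$ and $n$ be positive integers. Let $A_1,\ldots,A_n$ be subsets of $\mathbb{C}$ each of cardinality $k$, and for $1\leqslant i<j\leqslant n$ let $S_{ij}$ be a subset of $\mathbb{C}$ with at most $2m-1$ elements. Let $q$ be a positive odd integer and let $\zeta_1,\ldots,\zeta_n$ be distinct $q$th roots of unity. Then $$\Big|\Big\{\sum_{i=1}^n a_i:\ a_i\in A_i \text{ for all } i,\ a_i\zeta_i\neq a_j\zeta_j\ \text{and}\ a_i-a_j\notin S_{ij}\ \text{whenever}\ i<j\Big\}\Big|\geqslant (k-1-m(n-1))n+1.$$ *)

(* Defs.v *)
From HB Require Import structures.
From mathcomp Require Import all_boot all_order all_algebra.
From mathcomp Require Import finmap.
From mathcomp Require Import complex.
From mathcomp Require Import Rstruct.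


Set Implicit Arguments.
Unset Strict Implicit.
Unset Printing Implicit Defensive.

Import Order.TTheory GRing.Theory Num.Theory.

Definition CC : Type := complex Rdefinitions.R.

(* [card_ge P N] : the set {x | P x} has at least N elements (N : int, so
   a nonpositive N makes it trivially true), i.e. |{x | P x}| >= N. *)
Definition card_ge (T : eqType) (P : T -> Prop) (N : int) : Prop :=
  exists s : seq T, [/\ uniq s, (forall x, x \in s -> P x) & (N <= Posz (size s))%R].

Definition restricted_sumset (n : nat) (A : 'I_n -> {fset CC})
  (S : 'I_n -> 'I_n -> {fset CC}) (zeta : 'I_n -> CC) (x : CC) : Prop :=
  exists a : 'I_n -> CC,
    [/\ (forall i, a i \in A i),
        (forall i j : 'I_n, (i < j)%N -> (a i * zeta i != a j * zeta j)%R),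
        (forall i j : 'I_n, (i < j)%N -> (a i - a j)%R \notin S i j)
      & x = (\sum_(i < n) a i)%R].

(* Main.v *)
Require Import Defs.
From HB Require Import structures.
From mathcomp Require Import all_boot all_order all_algebra all_fingroup.
From mathcomp Require Import finmap.
From mathcomp Require Import complex.
From mathcomp Require Import Rstruct.
From mathcomp Require Import ssrcomplements mpoly ring zify.

(* Write K = k - 1 and let D = prod_(i < j) (x_j - x_i). If there were only
   N = (K - m(n-1))n admissible sums, the product over i < j of the factors
   (z_j x_j - z_i x_i) and (x_j - x_i + s), times the product over the sums c of
   (x_1 + ... + x_n - c), would vanish on A_1 x ... x A_n; by the combinatorial
   Nullstellensatz its coefficient at x_1^K ... x_n^K would be 0. That
   coefficient is the one of D^(2m-1) prod_(i < j) (z_j x_j - z_i x_i)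
   (x_1 + ... + x_n)^N, and it does not vanish:

   - up to a nonzero factor it is L_K(D^(2m-1) prod_(i < j) (z_j x_j - z_i x_i)),
     where the linear form L_K replaces each power x_i^a by the falling factorial
     K (K-1) ... (K-a+1). Antisymmetry of D turns the second Vandermonde product
     into a permanent: the value is per(z_j^i) L_K(D^(2m)) / n!.
   - Aomoto's integration by parts, applied to L_K, shows that
     (K+1)^n L_K(D^(2m)) is a multiple of L_(K+1)(D^(2m)), so it is enough to
     treat K = m(n-1). There L_K(D^(2m)) is a multiple of the coefficient of
     D^(2m) at x_1^K ... x_n^K; as D is antisymmetric under inversion of all
     the variables, this is plus or minus the sum of the squares of the
     coefficients of D^m.
   - per(z_j^i) and det(z_j^i) are congruent modulo 2 in the ring of algebraic
     integers, while the Vandermonde determinant of distinct q-th roots of unity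
     divides a power of the odd number q, so the permanent is not 0. *)

Set Implicit Arguments.
Unset Strict Implicit.
Unset Printing Implicit Defensive.

Import Order.TTheory GRing.Theory Num.Theory.
Local Open Scope ring_scope.

(** * Combinatorial Nullstellensatz and top forms *)

(** The weights are the last column of the inverse Vandermonde matrix; they read off the coefficient
    of degree [K] from the values at [K.+1] points. *)
Lemma top_coef_weights (F : fieldType) (K : nat) (a : 'I_K.+1 -> F) :
  injective a -> exists w : 'I_K.+1 -> F,
    forall j : nat, (j <= K)%N -> \sum_t w t * a t ^+ j = (j == K)%:R.
Proof.
move=> inj_a; pose V := Vandermonde K.+1 (\row_t a t).
have uV : V \in unitmx.
  rewrite unitmxE unitfE det_Vandermonde; apply/prodf_neq0 => i _.
  apply/prodf_neq0 => j ltij; rewrite !mxE subr_eq0.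
  by apply: contraTneq ltij => /inj_a ->; rewrite ltnn.
pose w : 'cV_K.+1 := invmx V *m delta_mx ord_max 0.
exists (fun t => w t 0) => j lejK.
have /matrixP/(_ (inord j) 0) : V *m w = delta_mx ord_max 0 by rewrite mulKVmx.
rewrite !mxE andbT -val_eqE /= inordK // => <-.
by apply: eq_bigr => t _; rewrite !mxE inordK // mulrC.
Qed.

(** Sum the values of [P] over the grid with products of these weights. A monomial then contributes
    a product of one-variable sums, which is 0 unless every exponent is [K]. *)
Lemma combinatorial_nullstellensatz (F : fieldType) (n K : nat)
    (P : {mpoly F[n]}) (a : 'I_n -> 'I_K.+1 -> F) :
  (forall i, injective (a i)) -> (msize P <= (n * K).+1)%N ->
  (forall f : {ffun 'I_n -> 'I_K.+1}, P.@[fun i => a i (f i)] = 0) ->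
  P@_[multinom K | i < n] = 0.
Proof.
move=> inj_a szP P0.
have /fin_all_exists[wt wtP] i := top_coef_weights (inj_a i).
have : \sum_(f : {ffun 'I_n -> 'I_K.+1})
    (\prod_i wt i (f i)) * P.@[fun i => a i (f i)] = 0.
  by apply: big1 => f _; rewrite P0 mulr0.
under eq_bigr => f _ do rewrite mevalE mulr_sumr.
rewrite exchange_big /=.
have E m : m \in msupp P ->
    \sum_(f : {ffun 'I_n -> 'I_K.+1}) (\prod_i wt i (f i)) *
      (P@_m * \prod_i a i (f i) ^+ m i)
    = P@_m * (m == [multinom K | i < n])%:R.
  move=> Pm; have dm : (\sum_i m i <= n * K)%N.
    by rewrite -mdegE -ltnS (leq_trans (msize_mdeg_lt Pm)).
  under eq_bigr => f _ do rewrite mulrCA -big_split /=.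
  rewrite -mulr_sumr; congr (_ * _).
  rewrite -(bigA_distr_bigA (fun i t => wt i t * a i t ^+ m i)) /=.
  have [->|nm] := eqVneq.
    by rewrite big1 // => i _; rewrite mnmE wtP // eqxx.
  (* Exponents all at least [K] would, by the degree bound, all equal [K]. *)
  have [i lti] : exists i, (m i < K)%N.
    apply/existsP; apply: contraNT nm; rewrite negb_exists => /forallP ge_m.
    have le i : (K <= m i)%N by rewrite leqNgt.
    have /leqif_sum/= h : forall i : 'I_n, true -> (K <= m i ?= iff (K == m i))%N.
      by move=> i _; apply/leqif_eq.
    have := h; rewrite sum_nat_const card_ord => h'.
    have : (n * K == \sum_i m i)%N by rewrite eqn_leq dm andbT h'.
    rewrite h' => /forallP/= e; apply/eqP/mnmP => i; rewrite mnmE.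
    by rewrite (eqP (e i)).
  by rewrite (bigD1 i) //= wtP ?(ltnW lti) // ltn_eqF // mul0r.
rewrite (eq_big_seq _ E) {E}.
have [iP|/memN_msupp_eq0 //] := boolP ([multinom K | i < n] \in msupp P).
rewrite (bigD1_seq _ iP) ?msupp_uniq //= eqxx mulr1 big1 ?addr0 //.
by move=> m /negPf ->; rewrite mulr0.
Qed.

(** [msize] is the degree plus one, so [f - f0] has degree below [d]. A relation, rather than a
    projection, lets [f0] be given in factored form. *)
Definition has_top_form (R : idomainType) (n d : nat) (f f0 : {mpoly R[n]}) :=
  f0 \is d.-homog /\ (msize (f - f0) <= d)%N.

Lemma top_form1 (R : idomainType) n : has_top_form 0 (1 : {mpoly R[n]}) 1.
Proof. by split; [exact: dhomog1|rewrite subrr msize0]. Qed.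

Lemma dhomog_msize_le (R : idomainType) n d (f : {mpoly R[n]}) :
  f \is d.-homog -> (msize f <= d.+1)%N.
Proof.
move=> hf; rewrite msizeE; apply/bigmax_leqP_seq => m mf _.
by rewrite (dhomog_mf hf mf).
Qed.

Lemma top_form_msize (R : idomainType) n d (f f0 : {mpoly R[n]}) :
  has_top_form d f f0 -> (msize f <= d.+1)%N.
Proof.
case=> /dhomog_msize_le h0 h; rewrite -(subrK f0 f).
by rewrite (leq_trans (msizeD_le _ _)) // geq_max h0 (leq_trans h).
Qed.

Lemma msizeM_bound (R : idomainType) n d e (f g : {mpoly R[n]}) :
  (msize f <= d)%N -> (msize g <= e.+1)%N -> (msize (f * g) <= d + e)%N.
Proof.
move=> hf hg; rewrite [X in (X <= _)%N]msizeE; apply/bigmax_leqP_seq => m.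
move=> /msuppM_le/allpairsP[[m1 m2] /= [/msize_mdeg_lt h1 /msize_mdeg_lt h2 ->]] _.
by rewrite mdegD -addSn leq_add // ?(leq_trans h1) // -ltnS (leq_trans h2).
Qed.

Lemma top_formM (R : idomainType) n d e (f f0 g g0 : {mpoly R[n]}) :
  has_top_form d f f0 -> has_top_form e g g0 ->
  has_top_form (d + e) (f * g) (f0 * g0).
Proof.
move=> hf hg; have [hf0 hf1] := hf; have [hg0 hg1] := hg.
split; first exact: dhomogM.
have -> : f * g - f0 * g0 = (f - f0) * g + f0 * (g - g0) by ring.
rewrite (leq_trans (msizeD_le _ _)) // geq_max.
rewrite msizeM_bound //; last exact: top_form_msize hg.
by rewrite mulrC addnC msizeM_bound // dhomog_msize_le.
Qed.

Lemma top_form_coef (R : idomainType) n d (f f0 : {mpoly R[n]}) (m : 'X_{1..n}) :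
  has_top_form d f f0 -> mdeg m = d -> f@_m = f0@_m.
Proof.
move=> [_ h] dm; apply/eqP; rewrite -subr_eq0 -mcoeffB mcoeff_eq0.
by apply: msize_mdeg_ge; rewrite dm.
Qed.

Lemma top_form_prod (R : idomainType) n (I : Type) (r : seq I) (P : pred I)
    (d : I -> nat) (f f0 : I -> {mpoly R[n]}) :
  (forall i, P i -> has_top_form (d i) (f i) (f0 i)) ->
  has_top_form (\sum_(i <- r | P i) d i)
    (\prod_(i <- r | P i) f i) (\prod_(i <- r | P i) f0 i).
Proof.
move=> h; elim: r => [|i r ih]; first by rewrite !big_nil; apply: top_form1.
by rewrite !big_cons; case: ifP => // /h hi; apply: top_formM.
Qed.

Lemma top_form_linear (R : idomainType) n (f : {mpoly R[n]}) (c : R) :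
  f \is 1.-homog -> has_top_form 1 (f + c%:MP) f.
Proof.
by move=> h; split=> //; rewrite [f + _]addrC addrK msizeC; case: (_ != _).
Qed.

Lemma top_form_prod_const (R : idomainType) n d k (f : 'I_k -> {mpoly R[n]}) f0 :
  (forall t, has_top_form d (f t) f0) ->
  has_top_form (k * d) (\prod_t f t) (f0 ^+ k).
Proof.
move=> h; have := @top_form_prod R n _ (index_enum 'I_k) xpredT (fun=> d) f (fun=> f0).
by rewrite sum_nat_const prodr_const card_ord; apply.
Qed.

(** * The falling-factorial functional *)

Definition mffact (n K : nat) (m : 'X_{1..n}) : nat := \prod_i K ^_ (m i).

(** This is the form L_K. Monomials with an exponent above [K] are sent to 0. *)
Definition umbral (R : idomainType) (n K : nat) (f : {mpoly R[n]}) : R :=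
  \sum_(m <- msupp f) f@_m * (mffact K m)%:R.

Lemma umbralwE (R : idomainType) n K k (f : {mpoly R[n]}) : (msize f <= k)%N ->
  umbral K f = \sum_(m : 'X_{1..n < k}) f@_m * (mffact K m)%:R.
Proof.
move=> le; pose I : subFinType _ := 'X_{1..n < k}.
rewrite /umbral (big_mksub I) ?msupp_uniq //=; first last.
  by move=> x /msize_mdeg_lt /leq_trans; apply.
by rewrite big_rmcond //= => i; move/memN_msupp_eq0 ->; rewrite mul0r.
Qed.

Lemma umbral_is_linear (R : idomainType) n K :
  scalar (@umbral R n K).
Proof.
move=> c f g; pose k := maxn (msize (c *: f + g)) (maxn (msize f) (msize g)).
rewrite !(@umbralwE _ _ K k) ?leq_max ?leqnn ?orbT //.
rewrite mulr_sumr -big_split /=; apply: eq_bigr => m _.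
by rewrite mcoeffD mcoeffZ mulrDl mulrA.
Qed.

HB.instance Definition _ (R : idomainType) n K :=
  GRing.isLinear.Build R {mpoly R[n]} R _ (@umbral R n K) (@umbral_is_linear R n K).

Lemma umbralX (R : idomainType) n K (m : 'X_{1..n}) :
  umbral K ('X_[m] : {mpoly R[n]}) = (mffact K m)%:R.
Proof. by rewrite /umbral msuppX big_seq1 mcoeffX eqxx mul1r. Qed.

Lemma linear_mpoly_ext (R : idomainType) n (g h : {mpoly R[n]} -> R) :
  scalar g -> scalar h -> (forall m, g 'X_[m] = h 'X_[m]) -> g =1 h.
Proof.
move=> gL hL e f.
pose gM := GRing.isLinear.Build R {mpoly R[n]} R _ g gL.
pose hM := GRing.isLinear.Build R {mpoly R[n]} R _ h hL.
pose G : {linear {mpoly R[n]} -> R | *%R} := HB.pack g gM.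
pose H : {linear {mpoly R[n]} -> R | *%R} := HB.pack h hM.
rewrite -[g]/(G : _ -> _) -[h]/(H : _ -> _) (mpolyE f) !linear_sum.
by apply: eq_bigr => m _; rewrite !linearZ /= e.
Qed.

Lemma umbral_msym (R : idomainType) n K (s : 'S_n) (f : {mpoly R[n]}) :
  umbral K (msym s f) = umbral K f.
Proof.
move: f; apply: linear_mpoly_ext.
- by move=> c f g; rewrite msymD msymZ linearP.
- exact: umbral_is_linear.
move=> m; rewrite msymX !umbralX; congr _%:R; rewrite /mffact.
rewrite [RHS](reindex_inj (@perm_inj _ (s^-1)%g)) /=.
by apply: eq_bigr => i _; rewrite mnmE.
Qed.

(* The integration-by-parts rule: [K ^_ a.+1 = (K - a) * K ^_ a]. *)
Lemma umbral_XM (R : idomainType) n K (i : 'I_n) (f : {mpoly R[n]}) :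
  umbral K ('X_i * f) = K%:R * umbral K f - umbral K ('X_i * f^`M(i)).
Proof.
move: f; apply: linear_mpoly_ext.
- by move=> c f g; rewrite mulrDr -scalerAr linearP.
- move=> c f g; rewrite mderivD mderivZ mulrDr -scalerAr !linearP /=; ring.
move=> m; rewrite -mpolyXD mderivX -scalerAr -mpolyXD linearZ /= !umbralX.
have -> : mffact K (U_(i) + m) = ((K - m i) * mffact K m)%N.
  rewrite /mffact (bigD1 i) //= [in RHS](bigD1 i) //= mnmDE mnm1E eqxx.
  rewrite add1n ffactnSr [(_ * (K - _))%N]mulnC -mulnA; congr (_ * (_ * _))%N.
  by apply: eq_bigr => j /negPf nj; rewrite mnmDE mnm1E eq_sym nj add0n.
have [mi0|mi] := eqVneq (m i) 0%N.
  by rewrite mi0 subn0 natrM mul0r subr0.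
rewrite addmC submK; last by rewrite lep1mP.
rewrite -mulrBl natrM.
have [le|lt] := leqP (m i) K; first by rewrite natrB.
by rewrite /mffact (bigD1 i) //= ffact_small // mul0n !mulr0.
Qed.

(** Each variable contributes [K.+1 ^_ a.+1 = K.+1 * K ^_ a]. *)
Lemma umbral_shift (R : idomainType) n K (f : {mpoly R[n]}) :
  umbral K.+1 ((\prod_i 'X_i) * f) = (K.+1 ^ n)%:R * umbral K f.
Proof.
move: f; apply: linear_mpoly_ext.
- by move=> c f g; rewrite mulrDr -scalerAr linearP.
- move=> c f g; rewrite !linearP /=; ring.
move=> m; rewrite mprodXE -mpolyXD !umbralX -natrM; congr _%:R.
rewrite /mffact -[n in (_ ^ n)%N]card_ord -prod_nat_const -big_split /=.
apply: eq_bigr => j _; rewrite mnmDE mnm_sumE (bigD1 j) //= mnm1E eqxx.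
rewrite big1 ?addn0 ?add1n ?ffactSS // => l /negPf lj.
by rewrite mnm1E lj.
Qed.

(** The multinomial theorem, cleared of denominators. *)
Lemma mcoeff_power_sum (R : idomainType) n N (m : 'X_{1..n}) : mdeg m = N ->
  (\prod_i (m i)`!)%:R * ((\sum_i 'X_i) ^+ N : {mpoly R[n]})@_m = (N`!)%:R.
Proof.
elim: N m => [|N ih] m dm.
  move/eqP: dm; rewrite mdeg_eq0 => /eqP->.
  rewrite expr0 mcoeff1 eqxx mulr1 big1 // => i _; by rewrite mnm0E.
rewrite exprSr mulr_sumr raddf_sum /= mulr_sumr.
rewrite factS natrM -dm mdegE natr_sum mulr_suml; apply: eq_bigr => i _.
have [mi0|mi] := eqVneq (m i) 0%N.
  rewrite mi0 mul0r; apply/eqP; rewrite mulf_eq0; apply/orP; right.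
  rewrite mcoeff_eq0; apply/negP; rewrite (perm_mem (msuppMX _ _)) => /mapP[m' _ em].
  by move: mi0; rewrite em mnmDE mnm1E eqxx.
have em : m = ((m - U_(i)) + U_(i))%MM by rewrite submK // lep1mP.
rewrite [X in _@_X]em addmC mcoeffMX.
rewrite -(ih (m - U_(i))%MM); last first.
  by move: dm; rewrite {1}em mdegD mdeg1 addn1 => -[].
rewrite mulrA -natrM; congr (_%:R * _).
rewrite (bigD1 i) //= [in RHS](bigD1 i) //= mnmBE mnm1E eqxx subn1.
rewrite mulnA -[in LHS](prednK (n := m i)) ?lt0n // factS prednK ?lt0n //.
by congr (_ * _)%N; apply: eq_bigr => j /negPf nj; rewrite mnmBE mnm1E eq_sym nj subn0.
Qed.

(** The power of the sum completes ['X_[m]] to the exponent (K, ..., K) with coefficient N! / prod_i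
    (K - m_i)!, and K! / (K - m_i)! is a falling factorial. If some m_i exceeds K, both sides get
    0. *)
Lemma umbral_top_coef (R : idomainType) n K d N (f : {mpoly R[n]}) :
  f \is d.-homog -> (d + N = n * K)%N ->
  (f * (\sum_i 'X_i) ^+ N)@_[multinom K | i < n] * (K`! ^ n)%:R
  = (N`!)%:R * umbral K f.
Proof.
move=> hf dN; rewrite [in LHS](mpolyE f) /umbral mulr_suml raddf_sum /= mulr_suml.
rewrite mulr_sumr; apply: eq_big_seq => m mf; have dm := dhomog_mf hf mf.
rewrite -scalerAl mcoeffZ -mulrA [RHS]mulrCA; congr (_ * _).
set k := [multinom K | i < n].
have [lemk|] := boolP (m <= k)%MM; last first.
  move=> nle.
  have /existsP[i Ki] : [exists i, (K < m i)%N].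
    apply: contraNT nle; rewrite negb_exists => /forallP h.
    by apply/mnm_lepP => i; rewrite mnmE leqNgt.
  have -> : mffact K m = 0%N by rewrite /mffact (bigD1 i) //= ffact_small.
  rewrite mulr0 memN_msupp_eq0 ?mul0r // -commr_mpolyX (perm_mem (msuppMX _ _)).
  apply/negP => /mapP[m' _ ek]; move/negP: nle; apply.
  by rewrite ek lem_addr.
rewrite -{1}[k](submK lemk) addmC -commr_mpolyX mcoeffMX.
rewrite -(mcoeff_power_sum R (m := (k - m)%MM) (N := N)); last first.
  apply/eqP; rewrite -(eqn_add2l d) dN -{1}dm addnC -mdegD submK //.
  by rewrite mdegE (eq_bigr (fun=> K)) ?sum_nat_const ?card_ord // => i _; rewrite mnmE.
rewrite mulrC mulrAC -natrM; congr (_%:R * _).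
rewrite -[n in (_ ^ n)%N]card_ord -prod_nat_const -big_split /=.
apply: eq_bigr => i _; rewrite mnmBE mnmE mulnC ffact_fact //.
by move/mnm_lepP: lemk => /(_ i); rewrite mnmE.
Qed.

(** * Vandermonde products and integration by parts *)

Definition vdm (R : idomainType) (n : nat) (z : 'I_n -> R) : {mpoly R[n]} :=
  \prod_(i < n) \prod_(j < n | (i < j)%N) (z j *: 'X_j - z i *: 'X_i).

Lemma vdm_det (R : idomainType) n (z : 'I_n -> R) :
  vdm z = \det (Vandermonde n (\row_i (z i *: 'X_i))).
Proof.
rewrite det_Vandermonde; apply: eq_bigr => i _; apply: eq_bigr => j _.
by rewrite !mxE.
Qed.

Definition vdm1 (R : idomainType) n : {mpoly R[n]} := vdm (fun=> 1).

Lemma vdm1_pairs (R : idomainType) n :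
  vdm1 R n = \prod_(p : 'I_n * 'I_n | (p.1 < p.2)%N) ('X_p.2 - 'X_p.1).
Proof.
rewrite /vdm1 /vdm pair_big_dep /=.
by apply: eq_bigr => p _; rewrite !scale1r.
Qed.

Lemma msym_Xi (R : idomainType) n (s : 'S_n) (i : 'I_n) :
  msym s 'X_i = 'X_(s i) :> {mpoly R[n]}.
Proof.
rewrite msymX; congr ('X_[_]); apply/mnmP => k; rewrite !mnmE.
by rewrite -(inj_eq (@perm_inj _ s)) permKV.
Qed.

Lemma msym_vdm1 (R : idomainType) n (s : 'S_n) :
  msym s (vdm1 R n) = (-1) ^+ s * vdm1 R n.
Proof.
rewrite /vdm1 vdm_det -det_map_mx /=.
have -> : map_mx (msym s) (Vandermonde n (\row_i (1 *: 'X_i)))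
    = col_perm s (Vandermonde n (\row_i (1 *: 'X_i))) :> 'M[{mpoly R[n]}]_n.
  apply/matrixP => i j; by rewrite !mxE rmorphXn /= !scale1r msym_Xi.
by rewrite col_permE det_mulmx det_perm odd_permV mulrC.
Qed.

Definition vandermonde_permanent (R : idomainType) n (z : 'I_n -> R) : R :=
  \sum_(s : 'S_n) \prod_i z (s i) ^+ i.

(** Expand the determinant [vdm z]. The sign of the term of [s] is absorbed by the odd power of D,
    so by symmetry of L_K every term yields the same constant. It does not depend on [z], so it can
    be found from [z = 1]. *)
Lemma umbral_vdm1_vdm (R : idomainType) n K e : odd e ->
  exists c, forall z : 'I_n -> R,
    umbral K (vdm1 R n ^+ e * vdm z) = vandermonde_permanent z * c.
Proof.
move=> odd_e; pose g : {mpoly R[n]} := vdm1 R n ^+ e * \prod_(i < n) 'X_i ^+ i.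
exists (umbral K g) => z.
rewrite vdm_det /determinant mulr_sumr raddf_sum /= mulr_suml.
apply: eq_bigr => s _.
rewrite -(umbral_msym K s g) -linearZ /=; congr umbral.
have sgn_e : ((-1) ^+ s) ^+ e = (-1) ^+ s :> {mpoly R[n]}.
  by rewrite -exprM mulnC exprM -signr_odd odd_e.
rewrite /g msymM rmorphXn /= msym_vdm1 exprMn sgn_e rmorph_prod /=.
rewrite [_ * vdm1 R n ^+ e]mulrC -mulrA scalerAr; congr (_ * _).
rewrite scalerAr; congr (_ * _).
rewrite -scaler_prod; apply: eq_bigr => i _.
by rewrite !mxE exprZn rmorphXn /= msym_Xi.
Qed.

Lemma mderiv_prod (R : idomainType) n (I : finType) (P : pred I)
    (f : I -> {mpoly R[n]}) (l : 'I_n) :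
  (\prod_(i | P i) f i)^`M(l) =
  \sum_(i | P i) (f i)^`M(l) * \prod_(j | P j && (j != i)) f j.
Proof.
have [k leP] := ubnP #|P|; elim: k => // k ih in P leP *.
have [i Pi|P0] := pickP P; last by rewrite !big_pred0 // -mpolyC1 mderivC.
rewrite (bigD1 i Pi) /= mderivM [RHS](bigD1 i Pi) /=; congr (_ + _).
rewrite ih; last first.
  rewrite -ltnS (leq_trans _ leP) // ltnS; apply: proper_card.
  apply/properP; split; first by apply/subsetP => j /andP[].
  by exists i; rewrite // unfold_in /= eqxx andbF.
rewrite mulr_sumr; apply: eq_bigr => j /andP[Pj ji].
rewrite mulrCA (bigD1 i (P := fun l => P l && (l != j))) /=; last first.
  by rewrite Pi eq_sym.
by congr (_ * (_ * _)); apply: eq_bigl => x; rewrite andbAC.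
Qed.

Lemma mderivXn (R : idomainType) n (f : {mpoly R[n]}) k (l : 'I_n) :
  (f ^+ k)^`M(l) = (k%:R * f ^+ k.-1) * f^`M(l).
Proof.
elim: k => [|[|k] ih]; first by rewrite expr0 -mpolyC1 mderivC !mul0r.
  by rewrite !expr1 expr0 !mul1r.
rewrite exprS mderivM ih /= -[k.+2%:R]natr1 exprS; ring.
Qed.

(** [E l j] is D / (x_l - x_j), so this is the logarithmic derivative of D written without
    fractions. *)
Lemma mderiv_vdm1 (R : idomainType) n : exists E : 'I_n -> 'I_n -> {mpoly R[n]},
  (forall l j, l != j -> ('X_l - 'X_j) * E l j = vdm1 R n) /\
  (forall l, (vdm1 R n)^`M(l) = \sum_(j | j != l) E l j).
Proof.
pose T (i j : 'I_n) : {mpoly R[n]} :=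
  \prod_(p : 'I_n * 'I_n | (p.1 < p.2)%N && (p != (i, j))) ('X_p.2 - 'X_p.1).
have TE (i j : 'I_n) : (i < j)%N -> ('X_j - 'X_i) * T i j = vdm1 R n.
  by move=> lt; rewrite vdm1_pairs (bigD1 (i, j)).
exists (fun l j : 'I_n => if (j < l)%N then T j l else - T l j); split => [l j lj|l].
  case: ifP => [/TE //|/negbT]; rewrite -leqNgt leq_eqVlt val_eqE (negPf lj) /=.
  by move=> /TE <-; ring.
rewrite vdm1_pairs mderiv_prod -(pair_big_dep xpredT (fun i j : 'I_n => (i < j)%N)
  (fun i j => ('X_j - 'X_i)^`M(l) * T i j)) /=.
have dX (i : 'I_n) : ('X_i : {mpoly R[n]})^`M(l) = (i == l)%:R.
  rewrite mderivX mnm1E; case: eqP => [->|_]; last by rewrite scale0r.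
  by rewrite scale1r -{1}[U_(l)%MM]add0m addmK mpolyX0.
under eq_bigr => i _ do under eq_bigr => j _ do rewrite mderivB !dX mulrBl.
under eq_bigr => i _ do rewrite sumrB.
rewrite sumrB [X in X - _](exchange_big_dep xpredT) //= (bigD1 l) //= [X in _ + X - _]big1 ?addr0; last first.
  by move=> j /negPf ->; rewrite big1 // => i _; rewrite mul0r.
rewrite [X in _ - X](bigD1 l) //= [X in _ - (_ + X)]big1 ?addr0; last first.
  by move=> j /negPf ->; rewrite big1 // => i _; rewrite mul0r.
under eq_bigr => i _ do rewrite eqxx mul1r.
under [X in _ - X]eq_bigr => i _ do rewrite eqxx mul1r.
rewrite [RHS](bigID (fun j : 'I_n => (j < l)%N)) /= -sumrN; congr (_ + _).
  by apply: eq_big => [j|j ->] //; rewrite -val_eqE neq_ltn; case: ltngtP.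
apply: eq_big => [j|j]; first by rewrite -val_eqE neq_ltn; case: ltngtP.
by move=> lt; rewrite ltnNge ltnW.
Qed.

(* Exchanging [x_l] and [x_j] negates [D / (x_l - x_j)], so the terms of the
   logarithmic derivative of [D] with [j < l] contribute 0 and those with
   [l < j] contribute half of [umbral K (P * D)]. *)
Lemma umbral_step (R : idomainType) n K m (l : 'I_n) : (0 < m)%N ->
  let P := \prod_(i < n | (i < l)%N) 'X_i : {mpoly R[n]} in
  let D := vdm1 R n ^+ (2 * m) in
  umbral K ('X_l * (P * D))
  = (K%:R - m%:R * #|[pred j : 'I_n | (l < j)%N]|%:R) * umbral K (P * D).
Proof.
move=> m0 P D; have [E0 [E0D E0d]] := mderiv_vdm1 R n.
pose E l j := vdm1 R n ^+ (2 * m).-1 * E0 l j.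
have ED i j : i != j -> ('X_i - 'X_j) * E i j = D.
  by move=> ij; rewrite mulrCA E0D // -exprSr prednK // muln_gt0.
have Dsym s : msym s D = D.
  by rewrite rmorphXn /= msym_vdm1 exprMn -exprM mulnCA exprM sqrrN !expr1n mul1r.
have Eanti i j : i != j -> msym (tperm i j) (E i j) = - E i j.
  move=> ij; apply/eqP; rewrite -addr_eq0; apply/eqP.
  have XX : 'X_i - 'X_j != 0 :> {mpoly R[n]}.
    rewrite subr_eq0; apply: contra ij => /eqP/(congr1 (mcoeff U_(j))).
    rewrite !mcoeffXU eqxx; case: (i == j) => //= /eqP.
    by rewrite eq_sym oner_eq0.
  apply: (mulfI XX); rewrite mulr0 mulrDr ED //.
  rewrite -(Dsym (tperm i j)) -(ED _ _ ij) msymM msymB !msym_Xi tpermL tpermR.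
  ring.
have half j : j != l -> 2%:R * umbral K ('X_l * P * E l j)
    = (l < j)%:R * umbral K (P * D).
  move=> jl; have lj : l != j by rewrite eq_sym.
  (* Add the image under the exchange of [l] and [j]. If [l < j], it fixes [P] and the difference
     x_l - x_j restores [D]; if [j < l], it fixes x_l [P] and the two terms cancel. *)
  rewrite mulr_natl mulr2n -{2}(umbral_msym K (tperm l j)) msymM Eanti // msymM msym_Xi tpermL.
  rewrite mulrN raddfN /= -raddfB /= -mulrBl.
  have Q (A : pred 'I_n) : ~~ A l -> ~~ A j ->
      msym (tperm l j) (\prod_(i | A i) 'X_i) = \prod_(i | A i) 'X_i :> {mpoly R[n]}.
    move=> Al Aj; rewrite rmorph_prod; apply: eq_bigr => i Ai /=.
    by rewrite msym_Xi tpermD //; [apply: contraNneq Al|apply: contraNneq Aj] => ->.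
  case: ltngtP => [lt|gt|eq_lj].
  - rewrite Q ?ltnn -?leqNgt ?(ltnW lt) // mul1r; congr umbral.
    by rewrite -mulrBl [_ * P]mulrC -mulrA ED.
  - have -> : P = 'X_j * \prod_(i < n | (i < l)%N && (i != j)) 'X_i.
      by rewrite /P (bigD1 j).
    rewrite msymM msym_Xi tpermR Q ?ltnn ?eqxx ?andbF //.
    by rewrite !mulrA ['X_l * 'X_j]mulrC subrr !mul0r raddf0.
  - by move: lj; rewrite -val_eqE /= eq_lj eqxx.
have dP : P^`M(l) = 0.
  rewrite /P mderiv_prod big1 // => i lt; rewrite mderivX mnm1E -val_eqE.
  by rewrite ltn_eqF // scale0r mul0r.
rewrite umbral_XM mderivM dP mul0r add0r mderivXn E0d mulrBl; congr (_ - _).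
transitivity (m%:R * \sum_(j | j != l) 2%:R * umbral K ('X_l * P * E l j)); last first.
  rewrite (eq_bigr _ half) -mulr_suml mulrA; congr (_ * _ * _).
  rewrite -natr_sum -sum1_card big_mkcond [in RHS]big_mkcond; congr _%:R.
  by apply: eq_bigr => j _; rewrite inE -val_eqE /=; case: ltngtP.
rewrite -mulr_sumr -raddf_sum [RHS]mulrA -natrM [RHS]mulr_natl -[RHS]raddfMn /= [(m * 2)%N]mulnC.
congr umbral; rewrite -mulr_natl -!mulr_sumr; ring.
Qed.

(** [umbral_step] multiplies by the variables one at a time; once all are present, [umbral_shift]
    lowers [K.+1] to [K]. Nonvanishing thus passes from [K] to [K.+1]. *)
Lemma umbral_vdm1_ratio (R : idomainType) n K m : (0 < m)%N ->
  exists c : R, (K.+1 ^ n)%:R * umbral K (vdm1 R n ^+ (2 * m))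
     = c * umbral K.+1 (vdm1 R n ^+ (2 * m)).
Proof.
move=> m0; set D := vdm1 R n ^+ (2 * m).
have step r : (r <= n)%N -> exists c : R,
    umbral K.+1 ((\prod_(i < n | (i < r)%N) 'X_i) * D) = c * umbral K.+1 D.
  elim: r => [|r ih] ltrn.
    by exists 1; rewrite big_pred0 // !mul1r.
  have [c hc] := ih (ltnW ltrn); pose l := Ordinal ltrn.
  exists ((K.+1%:R - m%:R * #|[pred j : 'I_n | (l < j)%N]|%:R) * c).
  rewrite -mulrA -hc -(umbral_step R K.+1 l m0) mulrA; congr (umbral _ (_ * _)).
  rewrite (bigD1 l) //=; congr (_ * _); apply: eq_bigl => i.
  by rewrite ltnS andbC ltn_neqAle -val_eqE.
have [c hc] := step n (leqnn n); exists c.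
rewrite -hc -umbral_shift; congr (umbral _ (_ * _)).
by apply: eq_bigl => i; rewrite ltn_ord.
Qed.

(** * The base case *)

(** Counts the factors of D that involve x_k. *)
Lemma pair_incidence n (k : 'I_n) :
  (\sum_(p : 'I_n * 'I_n | (p.1 < p.2)%N) ((k == p.1) + (k == p.2)) = n.-1)%N.
Proof.
rewrite -(pair_big_dep xpredT (fun i j : 'I_n => (i < j)%N)
  (fun i j => (k == i) + (k == j))%N) /=.
under eq_bigr => i _ do rewrite big_split /=.
rewrite big_split /= (bigD1 k) //= [X in (_ + X + _)%N]big1 ?addn0; last first.
  by move=> i /negPf ik; rewrite big1 // => j _; rewrite eq_sym ik.
rewrite (exchange_big_dep xpredT) //= [X in (_ + X)%N](bigD1 k) //=.
rewrite [X in (_ + (_ + X))%N]big1 ?addn0; last first.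
  by move=> i /negPf ik; rewrite big1 // => j _; rewrite eq_sym ik.
rewrite eqxx !sum1_card -[n in RHS]card_ord -(cardC1 k).
rewrite -[RHS](cardID [pred j : 'I_n | (k < j)%N]).
congr (_ + _)%N; apply: eq_card => j.
  by rewrite !inE /= -val_eqE /=; case: ltngtP.
by rewrite -[LHS]/(j < k)%N !inE /= -val_eqE /=; case: ltngtP.
Qed.

Lemma dhomog_bigprod (R : idomainType) n (I : Type) (r : seq I) (P : pred I)
    (d : I -> nat) (f : I -> {mpoly R[n]}) :
  (forall i, P i -> f i \is (d i).-homog) ->
  \prod_(i <- r | P i) f i \is (\sum_(i <- r | P i) d i).-homog.
Proof.
move=> h; elim/big_rec2: _ => [|i d' f' Pi h']; first exact: dhomog1.
by apply: dhomogM => //; apply: h.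
Qed.

Lemma dhomog_scale_sub (R : idomainType) n (c d : R) (i j : 'I_n) :
  (c *: 'X_i - d *: 'X_j : {mpoly R[n]}) \is 1.-homog.
Proof. by rewrite rpredB // dhomogZ // dhomogX /= mdeg1. Qed.

Definition npairs n := #|[pred p : 'I_n * 'I_n | (p.1 < p.2)%N]|.

Lemma npairs_double n : (npairs n * 2 = n * n.-1)%N.
Proof.
transitivity (\sum_(k < n) n.-1)%N; last by rewrite sum_nat_const card_ord.
under [RHS]eq_bigr => k _ do rewrite -(pair_incidence k).
rewrite exchange_big /= /npairs -sum_nat_const; apply: eq_bigr => p _.
rewrite big_split /= (bigD1 p.1) //= eqxx big1 => [|k /negPf-> //].
by rewrite (bigD1 p.2) //= eqxx big1 => [|k /negPf-> //].
Qed.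

Lemma vdm_homog (R : idomainType) n (z : 'I_n -> R) : vdm z \is (npairs n).-homog.
Proof.
rewrite /vdm pair_big_dep /= /npairs -sum1_card.
by apply: dhomog_bigprod => p _; apply: dhomog_scale_sub.
Qed.

(* Substituting the product of the other variables for each [x_i] plays the role
   of [x_i -> 1 / x_i] while staying inside polynomials: on forms of degree [d] it
   sends ['X_[m]] to ['X_[(d, ..., d) - m]]. *)
Definition coord_inversion (R : idomainType) n : n.-tuple {mpoly R[n]} :=
  [tuple \prod_(k < n | k != i) 'X_k | i < n].

(** The inverted monomial of [m] pairs with [m] alone to give the exponent (d, ..., d). *)
Lemma mcoeff_inversion (R : idomainType) n d (f : {mpoly R[n]}) : f \is d.-homog ->
  (f * (f \mPo coord_inversion R n))@_[multinom d | i < n]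
  = \sum_(m <- msupp f) f@_m ^+ 2.
Proof.
move=> hf; rewrite (comp_mpolyEX f) mulr_sumr raddf_sum /=.
apply: eq_big_seq => m mf; have dm : mdeg m = d := dhomog_mf hf mf.
pose m' := [multinom (d - m i)%N | i < n].
have -> : 'X_[m] \mPo coord_inversion R n = 'X_[m'].
  rewrite comp_mpolyX.
  under eq_bigr => i _ do rewrite tnth_mktuple mprodXE mpolyXn.
  rewrite mprodXE; congr 'X_[_]; apply/mnmP => l; rewrite mnm_sumE mnmE.
  rewrite -dm mdegE [in RHS](bigD1 l) //= addKn (bigD1 l) //=.
  rewrite mulmnE mnm_sumE big1 ?mul0n ?add0n; last by move=> k /negPf kl; rewrite mnm1E kl.
  apply: eq_bigr => i il; rewrite mulmnE mnm_sumE (bigD1 l) 1?eq_sym //= mnm1E eqxx.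
  by rewrite big1 ?mul1n // => k /andP[_ /negPf kl]; rewrite mnm1E kl.
rewrite -scalerAr mcoeffZ expr2; congr (_ * _).
have -> : [multinom d | _ < n] = (m' + m)%MM.
  apply/mnmP => i; rewrite mnmDE !mnmE subnK // -dm mdegE (bigD1 i) //=.
  exact: leq_addr.
by rewrite mcoeffMX.
Qed.

(** Inversion turns x_j - x_i into x_i - x_j times the product of the other variables; x_l occurs in
    that product for every pair not containing l. *)
Lemma vdm1_inversion (R : idomainType) n :
  vdm1 R n \mPo coord_inversion R n = (-1) ^+ npairs n * vdm1 R n *
   'X_[[multinom (npairs n - n.-1)%N | i < n]].
Proof.
have -> : 'X_[[multinom (npairs n - n.-1)%N | i < n]] =
  \prod_(p : 'I_n * 'I_n | (p.1 < p.2)%N)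
    \prod_(k | (k != p.1) && (k != p.2)) 'X_k :> {mpoly R[n]}.
  under eq_bigr => p _ do rewrite mprodXE.
  rewrite mprodXE; congr 'X_[_]; apply/mnmP => l; rewrite mnm_sumE mnmE.
  rewrite -(pair_incidence l) /npairs -sum1_card -sumnB; last first.
    move=> p lt; case: (eqVneq l p.1) => [->|_]; last by case: eqP.
    by rewrite -val_eqE /= (ltn_eqF lt).
  apply: eq_bigr => p lt; rewrite mnm_sumE big_mkcond (bigD1 l) //= mnm1E eqxx.
  rewrite big1 ?addn0; last by move=> k /negPf kl; rewrite mnm1E kl; case: ifP.
  by do 2!case: eqP.
rewrite vdm1_pairs rmorph_prod /= /npairs -prodr_const -!big_split /=.
apply: eq_bigr => p lt; rewrite raddfB /=.
have pp : p.1 != p.2 by rewrite -val_eqE /= ltn_eqF.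
rewrite !comp_mpolyXU -!tnth_nth !tnth_mktuple.
rewrite (bigD1 p.1) //= [in X in _ - X](bigD1 p.2) 1?eq_sym //=.
rewrite [X in _ - _ * X](eq_bigl (fun k => (k != p.2) && (k != p.1))); last first.
  by move=> k; rewrite andbC.
under [X in _ = _ * X]eq_bigl => k do rewrite andbC.
ring.
Qed.

Lemma mcoeff_vdm1_even (R : numDomainType) n m :
  (vdm1 R n ^+ (2 * m))@_[multinom (m * n.-1)%N | i < n] != 0.
Proof.
pose f := vdm1 R n ^+ m.
have f0 : f != 0.
  rewrite expf_eq0 negb_and; apply/orP; right.
  rewrite vdm1_pairs; apply/prodf_neq0 => p lt.
  rewrite subr_eq0; apply/eqP => /(congr1 (mcoeff U_(p.1))).
  rewrite !mcoeffXU eqxx -val_eqE /= gtn_eqF // => /esym/eqP.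
  by rewrite oner_eq0.
have fh : f \is (npairs n * m).-homog by apply: dhomogMn; apply: vdm_homog.
(* Integer coefficients have nonnegative squares even when [R] is not totally ordered, as for
   complex numbers. *)
have fR k : f@_k \is Num.real.
  have -> : f = map_mpoly intr (vdm1 int n ^+ m).
    rewrite rmorphXn /= /f !vdm1_pairs rmorph_prod; congr (_ ^+ m).
    by apply: eq_bigr => p _; rewrite rmorphB /= !map_mpolyX.
  by rewrite mcoeff_map_mpoly realz.
have pos : 0 < \sum_(k <- msupp f) f@_k ^+ 2.
  have sq k : 0 <= f@_k ^+ 2 by rewrite real_exprn_even_ge0 // fR.
  rewrite (bigD1_seq _ (mlead_supp f0)) ?msupp_uniq //=.
  rewrite ltr_wpDr ?sumr_ge0 // lt_def sq andbT expf_eq0 /=.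
  by rewrite mleadc_eq0.
rewrite -(mcoeff_inversion fh) rmorphXn /= vdm1_inversion in pos.
apply: contraTneq pos => z.
(* Cancelling the monomial produced by the inversion leaves the exponent m(n-1). *)
have -> : [multinom (npairs n * m)%N | i < n]
    = ([multinom (npairs n - n.-1)%N | i < n] *+ m + [multinom (m * n.-1)%N | i < n])%MM.
  apply/mnmP => i; rewrite mnmDE mulmnE !mnmE [(m * _)%N]mulnC -mulnDl subnK //.
  rewrite -(leq_pmul2r (m := 2)) // npairs_double mulnC leq_mul2r orbC.
  by case: (n) => [|[|n']].
rewrite /f !exprMn mpolyXn.
set mu := 'X_[_]; rewrite (_ : _ * _ =
    (((-1) ^+ npairs n) ^+ m * vdm1 R n ^+ (2 * m)) * mu); last first.
  by rewrite mul2n -addnn exprD; ring.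
rewrite mcoeffMX -exprM -mpolyC1 -mpolyCN -rmorphXn /= mcoeffCM.
by rewrite z mulr0 ltxx.
Qed.

(** * The permanent of roots of unity *)

Definition alg_int (F : numFieldType) (x : F) := integralOver (intr : int -> F) x.

Lemma alg_int_prod (F : numFieldType) (I : Type) (r : seq I) (P : pred I) (f : I -> F) :
  (forall i, P i -> alg_int (f i)) -> alg_int (\prod_(i <- r | P i) f i).
Proof.
move=> h; elim/big_rec: _ => [|i x Pi hx]; first exact: integral1.
by apply: integral_mul => //; apply: h.
Qed.

Lemma alg_int_sum (F : numFieldType) (I : Type) (r : seq I) (P : pred I) (f : I -> F) :
  (forall i, P i -> alg_int (f i)) -> alg_int (\sum_(i <- r | P i) f i).
Proof.
move=> h; elim/big_rec: _ => [|i x Pi hx]; first exact: integral0.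
by apply: integral_add => //; apply: h.
Qed.

Lemma alg_intX (F : numFieldType) (x : F) k : alg_int x -> alg_int (x ^+ k).
Proof.
move=> h; elim: k => [|k ih]; first exact: integral1.
by rewrite exprS; apply: integral_mul.
Qed.

Lemma alg_int_root1 (F : numFieldType) (z : F) q : (0 < q)%N -> z ^+ q = 1 -> alg_int z.
Proof.
move=> q0 zq; exists ('X^q - 1); first by rewrite monicXnsubC.
by rewrite rmorphB rmorph1 /= map_polyXn rootE !hornerE zq subrr.
Qed.

(** Multiply a monic equation of degree d for [x] by 2^d and put N = 2x: every term but N^d is even,
    so N^d would be even. *)
Lemma odd_half_not_alg_int (F : numFieldType) (N : nat) (x : F) :
  odd N -> alg_int x -> x *+ 2 <> N%:R.
Proof.
move=> oddN [p mon_p px] x2.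
have sp : (0 < size p)%N by rewrite size_poly_gt0 monic_neq0.
pose d := (size p).-1.
have : \sum_(i < size p) p`_i * (N%:Z ^+ i * 2 ^+ (d - i)) = 0 :> int.
  apply: (@intr_inj F); rewrite raddf_sum /=.
  transitivity (2 ^+ d * (map_poly intr p).[x]); last by rewrite (rootP px) mulr0.
  rewrite horner_coef size_map_poly_id0; last by rewrite (monicP mon_p) oner_eq0.
  rewrite mulr_sumr; apply: eq_bigr => i _; rewrite coef_map /= !(intrM, rmorphXn) /=.
  rewrite -pmulrn -x2 -[x *+ 2]mulr_natl exprMn.
  have -> : 2 ^+ d = 2 ^+ (d - i) * 2 ^+ i :> F.
    by rewrite -exprD subnK // -ltnS prednK.
  ring.
rewrite -(prednK sp) big_ord_recr /= -/d.
rewrite (_ : p`_d = 1) ?subnn ?expr0 ?mulr1 ?mul1r; last exact: (monicP mon_p).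
move/eqP; rewrite addrC addr_eq0 => /eqP e.
have : (2 %| N%:Z ^+ d)%Z.
  rewrite e rpredN rpred_sum // => i _; apply/dvdz_mull/dvdz_mull.
  by rewrite dvdz_exp // subn_gt0.
by rewrite dvdzE abszX /= dvdn2 oddX oddN orbT.
Qed.

(* With [u = y / x], [q = sum_(i < q) (1 - u ^+ i)] since the powers of [u] sum to 0. *)
Lemma root1_diff_dvd (F : numFieldType) (x y : F) q : (0 < q)%N ->
  x ^+ q = 1 -> y ^+ q = 1 -> x != y -> exists2 w, alg_int w & (x - y) * w = q%:R.
Proof.
move=> q0 xq yq xy.
have nz (t : F) : t ^+ q = 1 -> t != 0.
  move=> tq; apply/eqP => t0; move: tq; rewrite t0 expr0n gtn_eqF // => /esym/eqP.
  by rewrite oner_eq0.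
have x0 := nz _ xq.
pose u := y / x.
have uq : u ^+ q = 1 by rewrite exprMn exprVn xq yq invr1 mulr1.
have u1 : u != 1 by apply: contra xy => /eqP h; rewrite -(divfK x0 y) -/u h mul1r.
have s0 : \sum_(i < q) u ^+ i = 0.
  apply: (mulfI (x := u - 1)); first by rewrite subr_eq0.
  by rewrite -subrX1 uq subrr mulr0.
have intu : alg_int u := alg_int_root1 q0 uq.
exists (x^-1 * \sum_(i < q) \sum_(j < i) u ^+ j).
  apply: integral_mul; first by apply: (alg_int_root1 q0); rewrite exprVn xq invr1.
  by apply: alg_int_sum => i _; apply: alg_int_sum => j _; apply: alg_intX.
rewrite mulrA mulrBl divff // -/u mulr_sumr.
under eq_bigr => i _ do rewrite -opprB mulNr -subrX1 opprB.
by rewrite sumrB s0 subr0 sumr_const card_ord.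
Qed.

(** Determinant and permanent differ by twice the sum over odd permutations. A zero permanent would
    make the determinant twice an algebraic integer, and then so would be a power of [q]. *)
Lemma vandermonde_permanent_neq0 (F : numFieldType) n q (z : 'I_n -> F) :
  odd q -> (forall i, z i ^+ q = 1) -> injective z -> vandermonde_permanent z != 0.
Proof.
move=> oddq zq inj_z; have q0 := odd_gt0 oddq; apply/eqP => per0.
have zint i k : alg_int (z i ^+ k) by apply/alg_intX/(alg_int_root1 q0).
pose V := Vandermonde n (\row_i z i).
have [u intu Vu] : exists2 u, alg_int u & \det V = u *+ 2.
  exists (- \sum_(s : 'S_n | odd_perm s) \prod_i z (s i) ^+ i).
    apply/integral_opp/alg_int_sum => s _.
    by apply: alg_int_prod => i _.
  transitivity (\det V - vandermonde_permanent z); first by rewrite per0 subr0.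
  rewrite /determinant /vandermonde_permanent -sumrB -sumrN -sumrMnl.
  rewrite (bigID (fun s : 'S_n => odd_perm s)) /= [X in _ + X]big1; last first.
    move=> s /negPf ->; rewrite expr0 mul1r; apply/eqP; rewrite subr_eq0.
    by apply/eqP; apply: eq_bigr => i _; rewrite !mxE.
  rewrite addr0; apply: eq_bigr => s ->; rewrite expr1 mulN1r -opprD mulNrn mulr2n.
  by congr (- (_ + _)); apply: eq_bigr => i _; rewrite !mxE.
have [w intw [N Vw]] : exists2 w, alg_int w & exists N, \det V * w = (q ^ N)%:R.
  rewrite det_Vandermonde pair_big_dep /=.
  elim/big_rec: _ => [|p v lt [w intw [N vw]]].
    by exists 1; [exact: integral1|exists 0%N; rewrite mulr1].
  have [] := @root1_diff_dvd _ (z p.2) (z p.1) q q0 => //.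
    by rewrite (inj_eq inj_z) -val_eqE /= gtn_eqF.
  move=> w' intw' h; exists (w * w'); first exact: integral_mul.
  exists N.+1; rewrite expnS natrM -h -vw !mxE; ring.
apply: (@odd_half_not_alg_int F (q ^ N) (u * w)).
- by rewrite oddX oddq orbT.
- exact: integral_mul.
- by rewrite -mulrnAl -Vu.
Qed.

(** * Restricted sums *)

Lemma umbral_vdm1_neq0 (R : numDomainType) n m K : (0 < m)%N -> (m * n.-1 <= K)%N ->
  umbral K (vdm1 R n ^+ (2 * m)) != 0.
Proof.
move=> m0 /subnK <-; elim: (K - m * n.-1)%N => [|d ih].
  have hom : vdm1 R n ^+ (2 * m) \is (npairs n * (2 * m)).-homog.
    by apply/dhomogMn/vdm_homog.
  (* At K = m(n-1) the degree of D^(2m) is already nK, so the power of the sum is trivial and L_K is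
     a multiple of one coefficient. *)
  have := @umbral_top_coef _ n (m * n.-1) (npairs n * (2 * m)) 0 _ hom.
  rewrite mulnA npairs_double addn0 expr0 mulr1 mul1r => /(_ ltac:(lia)) <-.
  by rewrite mulf_neq0 ?mcoeff_vdm1_even // pnatr_eq0 -lt0n expn_gt0 fact_gt0.
have [c hc] := umbral_vdm1_ratio R n (d + m * n.-1) m0.
apply: contraNneq ih => z; move: hc; rewrite -addSn z mulr0 => /eqP.
by rewrite mulf_eq0 pnatr_eq0 expn_eq0.
Qed.

Lemma mcoeff_restricted_sum_form (F : numFieldType) n m N K q (z : 'I_n -> F) :
  (0 < m)%N -> odd q -> (forall i, z i ^+ q = 1) -> injective z ->
  (n * (m * n.-1) + N = n * K)%N -> (m * n.-1 <= K)%N ->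
  (vdm1 F n ^+ (2 * m - 1) * vdm z * (\sum_i 'X_i) ^+ N)@_[multinom K | i < n] != 0.
Proof.
move=> m0 oddq zq inj_z dK leK.
have e0 : odd (2 * m - 1) by lia.
have [c hc] := umbral_vdm1_vdm F n K e0.
have hom : vdm1 F n ^+ (2 * m - 1) * vdm z \is (npairs n * (2 * m - 1) + npairs n).-homog.
  by apply: dhomogM; [apply/dhomogMn/vdm_homog|apply: vdm_homog].
have := umbral_top_coef (K := K) (N := N) hom.
have -> : (npairs n * (2 * m - 1) + npairs n = n * (m * n.-1))%N.
  by have := npairs_double n; nia.
move=> /(_ dK); rewrite hc => h; apply/eqP => z0; move/eqP: h.
rewrite z0 mul0r eq_sym !mulf_eq0 pnatr_eq0 eqn0Ngt fact_gt0 /=.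
rewrite (negPf (vandermonde_permanent_neq0 oddq zq inj_z)) /= => /eqP c0.
(* The same [c] serves [z = 1], where [vdm z] is D and the form is L_K(D^(2m)). *)
have := umbral_vdm1_neq0 F m0 leK.
have -> : vdm1 F n ^+ (2 * m) = vdm1 F n ^+ (2 * m - 1) * vdm (fun=> 1).
  by rewrite -exprSr; congr (_ ^+ _); lia.
by rewrite hc c0 mulr0 eqxx.
Qed.

(** A nonzero value of the product is exactly what the three conditions need: a factor x_j - x_i + s
    excludes the difference a_i - a_j = s. The list [c] is arbitrary, so that it can later be all
    admissible sums. *)
Lemma restricted_sum_avoiding (F : numFieldType) n m N K q (z : 'I_n -> F)
    (a : 'I_n -> 'I_K.+1 -> F) (S : 'I_n -> 'I_n -> seq F) (c : seq F) :
  (0 < m)%N -> odd q -> (forall i, z i ^+ q = 1) -> injective z ->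
  (n * (m * n.-1) + N = n * K)%N -> (m * n.-1 <= K)%N ->
  (forall i, injective (a i)) ->
  (forall i j : 'I_n, (i < j)%N -> (size (S i j) <= 2 * m - 1)%N) ->
  (size c <= N)%N ->
  exists f : {ffun 'I_n -> 'I_K.+1},
    [/\ forall i j : 'I_n, (i < j)%N -> a i (f i) * z i != a j (f j) * z j,
        forall i j : 'I_n, (i < j)%N -> a i (f i) - a j (f j) \notin S i j &
        \sum_i a i (f i) \notin c].
Proof.
move=> m0 oddq zq inj_z dK leK inj_a szS szc.
(* The default value 0 of [nth] pads [S i j] and [c] to full length; the extra
   factors only make the product vanish more often. *)
pose PS : {mpoly F[n]} := \prod_(i < n) \prod_(j < n | (i < j)%N)
  \prod_(t < 2 * m - 1) ('X_j - 'X_i + ((S i j)`_t)%:MP).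
pose Pc : {mpoly F[n]} := \prod_(t < N) (\sum_i 'X_i + (- c`_t)%:MP).
have sum_hom : \sum_i 'X_i \is [in F[n], 1.-homog].
  by rewrite rpred_sum // => i _; rewrite dhomogX /= mdeg1.
have topS : has_top_form (npairs n * (2 * m - 1)) PS (vdm1 F n ^+ (2 * m - 1)).
  rewrite /PS pair_big_dep vdm1_pairs -prodrXl /= /npairs -sum_nat_const.
  apply: top_form_prod => p _; rewrite -[(2 * m - 1)%N in X in has_top_form X]muln1.
  apply: top_form_prod_const => t; apply: top_form_linear.
  by rewrite -['X_p.2]scale1r -['X_p.1]scale1r dhomog_scale_sub.
have topz : has_top_form (npairs n) (vdm z) (vdm z).
  by split; [apply: vdm_homog|rewrite subrr msize0].
have topc : has_top_form N Pc ((\sum_i 'X_i) ^+ N).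
  rewrite -[N in X in has_top_form X]muln1.
  by apply: top_form_prod_const => t; apply: top_form_linear.
have := top_formM (top_formM topS topz) topc.
have -> : (npairs n * (2 * m - 1) + npairs n + N = n * K)%N.
  by have := npairs_double n; nia.
set P := _ * Pc => topP.
have [f Pf] : exists f : {ffun 'I_n -> 'I_K.+1}, P.@[fun i => a i (f i)] != 0.
  apply/existsP; apply: contraT; rewrite negb_exists => /forallP P0.
  have := mcoeff_restricted_sum_form m0 oddq zq inj_z dK leK.
  rewrite -(top_form_coef topP); last first.
    by rewrite mdegE (eq_bigr (fun=> K)) ?sum_nat_const ?card_ord // => i _; rewrite mnmE.
  rewrite (combinatorial_nullstellensatz inj_a) ?eqxx // ?(top_form_msize topP) //.
  by move=> f; apply/eqP; rewrite -[_ == _]negbK.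
exists f; move: Pf; rewrite !mevalM !mulf_eq0 !negb_or -andbA !rmorph_prod /=.
case/and3P => /prodf_neq0 hS /prodf_neq0 hz /prodf_neq0 hc; split=> [i j lt|i j lt|].
- have := hz i isT; rewrite rmorph_prod /= => /prodf_neq0/(_ j lt).
  by rewrite rmorphB /= !mevalZ !mevalXU subr_eq0 eq_sym ![z _ * _]mulrC.
- have := hS i isT; rewrite rmorph_prod /= => /prodf_neq0/(_ j lt).
  rewrite rmorph_prod /= => /prodf_neq0 h; apply/negP => /(nthP 0)[t ltt e].
  have /= := h (Ordinal (leq_trans ltt (szS _ _ lt))) isT.
  by rewrite rmorphD rmorphB /= !mevalXU mevalC e; apply/negP/negPn/eqP; ring.
- apply/negP => /(nthP 0)[t ltt e].
  have /= := hc (Ordinal (leq_trans ltt szc)) isT.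
  rewrite rmorphD rmorph_sum /= mevalC e.
  under eq_bigr => i _ do rewrite mevalXU.
  by rewrite subrr eqxx.
Qed.

Local Open Scope fset_scope.

Theorem theorem1p2 (k m n : nat) (hk : (0 < k)%N) (hm : (0 < m)%N) (hn : (0 < n)%N)
  (A : 'I_n -> {fset CC}) (hA : forall i, #|` A i| = k)
  (S : 'I_n -> 'I_n -> {fset CC})
  (hS : forall i j : 'I_n, (i < j)%N -> (#|` S i j| <= 2 * m - 1)%N)
  (q : nat) (hq : (0 < q)%N) (hqodd : odd q)
  (zeta : 'I_n -> CC) (hzeta : forall i, (zeta i ^+ q = 1)%R)
  (hinj : injective zeta) :
  card_ge (restricted_sumset A S zeta)
    (((k%:Z - 1 - m%:Z * (n%:Z - 1)) * n%:Z + 1)%R).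
Proof.
case: k hk hA => // K _ hA.
have [ltK|leK] := ltnP K (m * n.-1).
  (* Here the bound is at most 1 - n, hence nonpositive. *)
  by exists [::]; split=> //=; nia.
pose a i (t : 'I_K.+1) : CC := nth 0%R (A i) t.
have inj_a i : injective (a i).
  move=> t t' /eqP; rewrite nth_uniq ?fset_uniq // ?hA //.
  by move=> /eqP/val_inj.
pose N := (n * K - n * (m * n.-1))%N.
pose good (f : {ffun 'I_n -> 'I_K.+1}) :=
  [forall i : 'I_n, forall j : 'I_n, (i < j)%N ==>
    (a i (f i) * zeta i != a j (f j) * zeta j)%R && (a i (f i) - a j (f j) \notin S i j)%R].
(* All admissible sums, each listed once. *)
pose c := undup [seq (\sum_i a i (f i))%R | f : {ffun 'I_n -> 'I_K.+1} in good].
exists c; split; first exact: undup_uniq.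
  move=> x; rewrite mem_undup => /imageP[f gf ->]; exists (fun i => a i (f i)).
  have g (i j : 'I_n) : (i < j)%N -> _ := implyP (forallP (forallP gf i) j).
  split=> // [i|i j /g/andP[]|i j /g/andP[]] //.
  by apply: mem_nth; rewrite hA.
have [lec|ltN] := leqP (size c) N; last first.
  have dK : (N + n * (m * n.-1) = n * K)%N by rewrite subnK // leq_mul2l leK orbT.
  have -> : (n%:Z - 1)%R = n.-1%:Z by lia.
  by move: (size c) (N) (n.-1) ltN dK => sc M p; clear; nia.
have dK : (n * (m * n.-1) + N = n * K)%N by rewrite subnKC // leq_mul2l leK orbT.
(* With at most [N] sums in [c], some admissible sum would lie outside [c], which is absurd. *)
have [f [h1 h2]] := restricted_sum_avoiding hm hqodd hzeta hinj dK leK inj_a hS lec.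
case/negP; rewrite mem_undup; apply/imageP; exists f => //.
apply/forallP => i; apply/forallP => j; apply/implyP => lt.
by rewrite h1 // h2.
Qed.
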